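(* Let $\mathcal{C} = (S_{\mathcal C}, \Sigma_{\mathcal C}, \mathit{next}_{\mathcal C}, \mathit{leak}_{\mathcal C})$ and $\mathcal{H} = (S_{\mathcal H}, \Sigma_{\mathcal H}, \mathit{next}_{\mathcal H}, \mathit{leak}_{\mathcal H})$ be two transition systems. Each of the following six functions $f$ on subsets $R$ of $S_{\mathcal C} \times S_{\mathcal C} \times S_{\mathcal H} \times S_{\mathcal H}$ is compatible with $\mathtt{rbisimF}^{\mathcal C,\mathcal H}$: 1. (C-Swap) $f(R) = \{ (s_1, s_2, h_1, h_2) \mid (s_2, s_1, h_1, h_2) \in R \}$; 2. (H-Swap) $f(R) = \{ (s_1, s_2, h_1, h_2) \mid (s_1, s_2, h_2, h_1) \in R \}$; 3. (C-Leak-Eq) $f(R) = \{ (s_1, s_2, h_1, h_2) \mid \exists s'_1 \in S_{\mathcal C}.\ (s_1, s'_1) \in \mathtt{bisim}^{\mathcal C} \wedge (s'_1, s_2, h_1, h_2) \in R \}$; 4. (H-Leak-Eq) $f(R) = \{ (s_1, s_2, h_1, h_2) \mid \exists h'_1 \in S_{\mathcal H}.\ (h_1, h'_1) \in \mathtt{bisim}^{\mathcal H} \wedge (s_1, s_2, h'_1, h_2) \in R \}$; 5. (Reduce-Contract-Leakage) $f(R) = \{ (s_1, s_2, h_1, h_2) \mid \exists s'_1, s'_2 \in S_{\mathcal C}.\ (s_1, s_2, s'_1, s'_2) \in \mathtt{rbisim}^{\mathcal C,\mathcal C} \wedge (s'_1, s'_2, h_1, h_2) \in R \}$; 6. (Augment-Hardware-Leakage)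 $f(R) = \{ (s_1, s_2, h_1, h_2) \mid \exists h'_1, h'_2 \in S_{\mathcal H}.\ (h'_1, h'_2, h_1, h_2) \in \mathtt{rbisim}^{\mathcal H,\mathcal H}_{\mathtt{lockstep}} \wedge (s_1, s_2, h'_1, h'_2) \in R \}$.
   Context: A transition system is a tuple $\mathcal T = (S, \Sigma, \mathit{next}, \mathit{leak})$, where $S$ is a set of states, $\Sigma$ is a set of observations, $\mathit{next} : S \to S$ is a transition function and $\mathit{leak} : S \to \Sigma$ is a leakage function. For a monotone function $F$ on the powerset of a set, $\nu F$ and $\mu F$ denote its greatest and least fixpoints. Compatibility: for monotone functions $f, F$ on subsets of a set $U$, $f$ is compatible with $F$ if $f(F(X)) \subseteq F(f(X))$ for all $X \subseteq U$. Bisimilarity: for a transition system $\mathcal T$, $\mathtt{bisim}^{\mathcal T} = \nu\,\mathtt{bisimF}$ where, for $R \subseteq S \times S$, $\mathtt{bisimF}(R) = \{ (s_1,s_2) \mid \mathit{leak}(s_1) = \mathit{leak}(s_2) \wedge (\mathit{next}(s_1), \mathit{next}(s_2)) \in R \}$. Relative bisimilarity: for transition systems $\mathcal A, \mathcal B$ and $R_1 \subseteq S_{\mathcal A} \times S_{\mathcal A} \times S_{\mathcal B} \times S_{\mathcal B}$, let $\mathtt{rbisimF}^{\mathcal A,\mathcal B}(R_1) = \mu R_2.\, \Psi(R_1,R_2)$, where $\Psi(R_1,R_2)$ is the union of $\{ (s_1, s_2, h_1, h_2) \mid \mathit{leak}_{\mathcal A}(s_1) \neq \mathit{leak}_{\mathcal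 A}(s_2) \}$, $\{ (s_1, s_2, h_1, h_2) \mid (\mathit{next}_{\mathcal A}(s_1), \mathit{next}_{\mathcal A}(s_2), h_1, h_2) \in R_2 \}$, and $\{ (s_1, s_2, h_1, h_2) \mid \mathit{leak}_{\mathcal B}(h_1) = \mathit{leak}_{\mathcal B}(h_2) \wedge (s_1, s_2, \mathit{next}_{\mathcal B}(h_1), \mathit{next}_{\mathcal B}(h_2)) \in R_1 \}$. Then $\mathtt{rbisim}^{\mathcal A,\mathcal B} = \nu\, \mathtt{rbisimF}^{\mathcal A,\mathcal B}$. Lockstep relative bisimilarity: $\mathtt{rbisim}^{\mathcal A,\mathcal B}_{\mathtt{lockstep}}$ is the greatest fixpoint of $$R \mapsto \{ (s_1, s_2, h_1, h_2) \mid \mathit{leak}_{\mathcal A}(s_1) \neq \mathit{leak}_{\mathcal A}(s_2) \} \cup \{ (s_1, s_2, h_1, h_2) \mid \mathit{leak}_{\mathcal B}(h_1) = \mathit{leak}_{\mathcal B}(h_2) \wedge (\mathit{next}_{\mathcal A}(s_1), \mathit{next}_{\mathcal A}(s_2), \mathit{next}_{\mathcal B}(h_1), \mathit{next}_{\mathcal B}(h_2)) \in R \}.$$ *)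

(* Defs.v *)
From mathcomp Require Import all_boot.
From mathcomp Require Import classical_sets.

Set Implicit Arguments.
Unset Strict Implicit.
Unset Printing Implicit Defensive.

Local Open Scope classical_set_scope.

(* Fixpoints and compatibility are only defined for monotone functions, so
   monotonicity is bundled with the function. *)
Record monotoneFun (U : Type) := MonotoneFun {
  monotone_fun :> set U -> set U;
  monotone_funP : forall X Y : set U,
    X `<=` Y -> monotone_fun X `<=` monotone_fun Y }.

(* Knaster-Tarski; the lemmas below show that these are the extremal
   fixpoints. *)
Definition nu (U : Type) (F : monotoneFun U) : set U :=
  \bigcup_(X in [set X | X `<=` F X]) X.

Definition mu (U : Type) (F : monotoneFun U) : set U :=
  \bigcap_(X in [set X | F X `<=` X]) X.

Lemma nu_max (U : Type) (F : monotoneFun U) (X : set U) :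
  X `<=` F X -> X `<=` nu F.
Proof. by move=> XF x Xx; exists X. Qed.

Lemma nu_fix (U : Type) (F : monotoneFun U) : F (nu F) = nu F.
Proof.
have nuF : nu F `<=` F (nu F).
  by move=> x [X XF Xx]; apply: (monotone_funP (nu_max XF)); exact: XF.
by apply/seteqP; split=> //; apply: nu_max; exact: monotone_funP.
Qed.

Lemma mu_min (U : Type) (F : monotoneFun U) (X : set U) :
  F X `<=` X -> mu F `<=` X.
Proof. by move=> FX x; exact. Qed.

Lemma mu_fix (U : Type) (F : monotoneFun U) : F (mu F) = mu F.
Proof.
have muF : F (mu F) `<=` mu F.
  by move=> x Fx X FX; apply: (FX); exact: (monotone_funP (mu_min FX)) Fx.
by apply/seteqP; split=> //; apply: mu_min; exact: monotone_funP.
Qed.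

Definition compatible (U : Type) (f F : monotoneFun U) : Prop :=
  forall X : set U, f (F X) `<=` F (f X).

Record transitionSystem := TransitionSystem {
  state : Type;
  observation : Type;
  next : state -> state;
  leak : state -> observation }.

Section Bisimilarity.
Variable T : transitionSystem.

Definition bisimF_fun (R : set (state T * state T)) :
    set (state T * state T) :=
  fun '(s1, s2) => leak s1 = leak s2 /\ R (next s1, next s2).

Lemma bisimF_monotone (R R' : set (state T * state T)) :
  R `<=` R' -> bisimF_fun R `<=` bisimF_fun R'.
Proof. by move=> RR' [s1 s2] [? /RR' ?]; split. Qed.

Definition bisimF := MonotoneFun bisimF_monotone.

Definition bisim : set (state T * state T) := nu bisimF.

End Bisimilarity.

Section RelativeBisimilarity.
Variables A B : transitionSystem.

Definition quad : Type := state A * state A * state B * state B.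

Definition rbisimPsi_fun (R1 R2 : set quad) : set quad :=
  ((fun '(s1, s2, h1, h2) => leak s1 <> leak s2) : set quad)
  `|` (fun '(s1, s2, h1, h2) => R2 (next s1, next s2, h1, h2))
  `|` (fun '(s1, s2, h1, h2) =>
         leak h1 = leak h2 /\ R1 (s1, s2, next h1, next h2)).

Lemma rbisimPsi_monotone (R1 R2 R2' : set quad) :
  R2 `<=` R2' -> rbisimPsi_fun R1 R2 `<=` rbisimPsi_fun R1 R2'.
Proof.
by move=> RR' [[[s1 s2] h1] h2] [[?|/RR' ?]|?]; [left; left|left; right|right].
Qed.

Definition rbisimPsi (R1 : set quad) : monotoneFun quad :=
  MonotoneFun (@rbisimPsi_monotone R1).

Definition rbisimF_fun (R1 : set quad) : set quad := mu (rbisimPsi R1).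

Lemma rbisimF_monotone (R R' : set quad) :
  R `<=` R' -> rbisimF_fun R `<=` rbisimF_fun R'.
Proof.
move=> RR'; apply: mu_min => x Px; rewrite /rbisimF_fun -mu_fix.
move: x Px => [[[s1 s2] h1] h2] [[?|?]|[? /RR' ?]].
- by left; left.
- by left; right.
- by right.
Qed.

Definition rbisimF : monotoneFun quad := MonotoneFun rbisimF_monotone.

Definition rbisim : set quad := nu rbisimF.

Definition rbisim_lockstepF_fun (R : set quad) : set quad :=
  ((fun '(s1, s2, h1, h2) => leak s1 <> leak s2) : set quad)
  `|` (fun '(s1, s2, h1, h2) =>
         leak h1 = leak h2 /\ R (next s1, next s2, next h1, next h2)).

Lemma rbisim_lockstepF_monotone (R R' : set quad) :
  R `<=` R' -> rbisim_lockstepF_fun R `<=` rbisim_lockstepF_fun R'.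
Proof.
by move=> RR' [[[s1 s2] h1] h2] [?|[? /RR' ?]]; [left|right].
Qed.

Definition rbisim_lockstepF : monotoneFun quad :=
  MonotoneFun rbisim_lockstepF_monotone.

Definition rbisim_lockstep : set quad := nu rbisim_lockstepF.

End RelativeBisimilarity.

Section UpToFunctions.
Variables C H : transitionSystem.
Implicit Types R : set (quad C H).

Definition c_swap_fun R : set (quad C H) :=
  fun '(s1, s2, h1, h2) => R (s2, s1, h1, h2).

Definition h_swap_fun R : set (quad C H) :=
  fun '(s1, s2, h1, h2) => R (s1, s2, h2, h1).

Definition c_leak_eq_fun R : set (quad C H) :=
  fun '(s1, s2, h1, h2) => exists s1' : state C,
    bisim (s1, s1') /\ R (s1', s2, h1, h2).

Definition h_leak_eq_fun R : set (quad C H) :=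
  fun '(s1, s2, h1, h2) => exists h1' : state H,
    bisim (h1, h1') /\ R (s1, s2, h1', h2).

Definition reduce_contract_leakage_fun R : set (quad C H) :=
  fun '(s1, s2, h1, h2) => exists s1' s2' : state C,
    rbisim (s1, s2, s1', s2') /\ R (s1', s2', h1, h2).

Definition augment_hardware_leakage_fun R : set (quad C H) :=
  fun '(s1, s2, h1, h2) => exists h1' h2' : state H,
    rbisim_lockstep (h1', h2', h1, h2) /\ R (s1, s2, h1', h2').

Lemma c_swap_monotone R R' : R `<=` R' -> c_swap_fun R `<=` c_swap_fun R'.
Proof. by move=> RR' [[[s1 s2] h1] h2] /RR'. Qed.

Lemma h_swap_monotone R R' : R `<=` R' -> h_swap_fun R `<=` h_swap_fun R'.
Proof. by move=> RR' [[[s1 s2] h1] h2] /RR'. Qed.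

Lemma c_leak_eq_monotone R R' :
  R `<=` R' -> c_leak_eq_fun R `<=` c_leak_eq_fun R'.
Proof. by move=> RR' [[[s1 s2] h1] h2] [s [? /RR' ?]]; exists s. Qed.

Lemma h_leak_eq_monotone R R' :
  R `<=` R' -> h_leak_eq_fun R `<=` h_leak_eq_fun R'.
Proof. by move=> RR' [[[s1 s2] h1] h2] [h [? /RR' ?]]; exists h. Qed.

Lemma reduce_contract_leakage_monotone R R' : R `<=` R' ->
  reduce_contract_leakage_fun R `<=` reduce_contract_leakage_fun R'.
Proof. by move=> RR' [[[s1 s2] h1] h2] [s [t [? /RR' ?]]]; exists s, t. Qed.

Lemma augment_hardware_leakage_monotone R R' : R `<=` R' ->
  augment_hardware_leakage_fun R `<=` augment_hardware_leakage_fun R'.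
Proof. by move=> RR' [[[s1 s2] h1] h2] [h [k [? /RR' ?]]]; exists h, k. Qed.

Definition c_swap := MonotoneFun c_swap_monotone.
Definition h_swap := MonotoneFun h_swap_monotone.
Definition c_leak_eq := MonotoneFun c_leak_eq_monotone.
Definition h_leak_eq := MonotoneFun h_leak_eq_monotone.
Definition reduce_contract_leakage :=
  MonotoneFun reduce_contract_leakage_monotone.
Definition augment_hardware_leakage :=
  MonotoneFun augment_hardware_leakage_monotone.

End UpToFunctions.

(* Main.v *)
Require Import Defs.
From mathcomp Require Import all_boot.
From mathcomp Require Import classical_sets.
(* [all_boot] shadows [Defs.next] by [path.next]. *)
Import Defs.

Set Implicit Arguments.
Unset Strict Implicit.
Unset Printing Implicit Defensive.

Local Open Scope classical_set_scope.

(* Each inclusion is an induction on the least fixpoint defining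
   [rbisimF C H R], with the existentially quantified states of the up-to
   function generalized.  Only contract-leakage reduction needs more: when the
   contract runs leak or step, the given element of [rbisim] is unfolded once and an
   inner induction on its own least fixpoint moves the augmented contract until
   it leaks a difference or allows the original contract to step. *)

Section RbisimF.
Variables A B : transitionSystem.
Implicit Types (R : set (quad A B)) (s : state A) (h : state B).

Lemma rbisimF_leak R s1 s2 h1 h2 :
  leak s1 <> leak s2 -> rbisimF A B R (s1, s2, h1, h2).
Proof. by move=> ?; rewrite /= /rbisimF_fun -mu_fix; left; left. Qed.

Lemma rbisimF_nextl R s1 s2 h1 h2 :
  rbisimF A B R (next s1, next s2, h1, h2) -> rbisimF A B R (s1, s2, h1, h2).
Proof. by move=> ?; rewrite /= /rbisimF_fun -mu_fix; left; right. Qed.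

Lemma rbisimF_nextr R s1 s2 h1 h2 :
    leak h1 = leak h2 -> R (s1, s2, next h1, next h2) ->
  rbisimF A B R (s1, s2, h1, h2).
Proof. by move=> ? ?; rewrite /= /rbisimF_fun -mu_fix; right. Qed.

(** [P] is curried so that [apply:] can infer it once the four states are generalized. The case of a
    [B] step has no induction hypothesis, since there the recursion passes to [R]. *)
Lemma rbisimF_ind R (P : state A -> state A -> state B -> state B -> Prop) :
    (forall s1 s2 h1 h2, leak s1 <> leak s2 -> P s1 s2 h1 h2) ->
    (forall s1 s2 h1 h2, P (next s1) (next s2) h1 h2 -> P s1 s2 h1 h2) ->
    (forall s1 s2 h1 h2,
       leak h1 = leak h2 -> R (s1, s2, next h1, next h2) -> P s1 s2 h1 h2) ->
  forall s1 s2 h1 h2, rbisimF A B R (s1, s2, h1, h2) -> P s1 s2 h1 h2.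
Proof.
move=> Pleak Pnextl Pnextr s1 s2 h1 h2 F1.
pose Q : set (quad A B) := fun '(s1, s2, h1, h2) => P s1 s2 h1 h2.
suff: rbisimPsi R Q `<=` Q by move=> /mu_min/(_ _ F1).
by move=> [[[t1 t2] k1] k2] [[/Pleak|/Pnextl]|[/Pnextr]]; apply.
Qed.

End RbisimF.

Lemma bisim_next (T : transitionSystem) (s1 s2 : state T) :
  bisim (s1, s2) -> leak s1 = leak s2 /\ bisim (next s1, next s2).
Proof. by rewrite {1}/bisim -nu_fix. Qed.

Section Compatibility.
Variables C H : transitionSystem.

Lemma c_swap_compatible : compatible (c_swap C H) (rbisimF C H).
Proof.
move=> R [[[s1 s2] h1] h2]; rewrite [c_swap _ _ _ _]/=.
move: s2 s1 h1 h2; apply: rbisimF_ind => s2 s1 h1 h2.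
- by move=> ne; apply: rbisimF_leak => /esym.
- exact: rbisimF_nextl.
- exact: rbisimF_nextr.
Qed.

Lemma h_swap_compatible : compatible (h_swap C H) (rbisimF C H).
Proof.
move=> R [[[s1 s2] h1] h2]; rewrite [h_swap _ _ _ _]/=.
move: s1 s2 h2 h1; apply: rbisimF_ind => s1 s2 h2 h1.
- exact: rbisimF_leak.
- exact: rbisimF_nextl.
- by move=> /esym; exact: rbisimF_nextr.
Qed.

(** Bisimilarity survives simultaneous contract steps, and a hardware step leaves the contract
    states fixed, so [s1'] is still the witness. *)
Lemma c_leak_eq_compatible : compatible (c_leak_eq C H) (rbisimF C H).
Proof.
move=> R [[[s1 s2] h1] h2] [s1' [+ F1]].
move: s1' s2 h1 h2 F1 s1.
apply: rbisimF_ind => s1' s2 h1 h2.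
- by move=> ne s1 /bisim_next[eq1 _]; apply: rbisimF_leak; rewrite eq1.
- by move=> IH s1 /bisim_next[_ /IH]; exact: rbisimF_nextl.
- by move=> eqh Rs s1 b1; apply: rbisimF_nextr => //; exists s1'.
Qed.

Lemma h_leak_eq_compatible : compatible (h_leak_eq C H) (rbisimF C H).
Proof.
move=> R [[[s1 s2] h1] h2] [h1' [+ F1]].
move: s1 s2 h1' h2 F1 h1.
apply: rbisimF_ind => s1 s2 h1' h2.
- by move=> ne h1 _; exact: rbisimF_leak.
- by move=> IH h1 /IH; exact: rbisimF_nextl.
- move=> eqh Rs h1 /bisim_next[eq1 b1].
  by apply: rbisimF_nextr; [rewrite eq1|exists (next h1')].
Qed.

Lemma reduce_contract_leakage_compatible :
  compatible (reduce_contract_leakage C H) (rbisimF C H).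
Proof.
move=> R [[[s1 s2] h1] h2] [s1' [s2' [+ F1]]].
move: s1' s2' h1 h2 F1 s1 s2.
apply: rbisimF_ind => s1' s2' h1 h2.
- move=> ne s1 s2; rewrite /rbisim -nu_fix => rs.
  move: s1 s2 s1' s2' rs ne; apply: rbisimF_ind => s1 s2 s1' s2'.
  + by move=> ? _; exact: rbisimF_leak.
  + by move=> IH /IH; exact: rbisimF_nextl.
  (* Equal leakage of [s1'] and [s2'] contradicts [ne]. *)
  + by [].
- move=> IH s1 s2; rewrite /rbisim -nu_fix => rs.
  move: s1 s2 s1' s2' rs IH; apply: rbisimF_ind => s1 s2 s1' s2'.
  + by move=> ? _; exact: rbisimF_leak.
  + by move=> IH2 /IH2; exact: rbisimF_nextl.
  (* The augmented contract now waits while [s1'] and [s2'] step, which is exactly what the outer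
     hypothesis [IH] asks for. *)
  + by move=> _ rs; apply.
- by move=> eqh Rs s1 s2 rs; apply: rbisimF_nextr => //; exists s1', s2'.
Qed.

Lemma augment_hardware_leakage_compatible :
  compatible (augment_hardware_leakage C H) (rbisimF C H).
Proof.
move=> R [[[s1 s2] h1] h2] [h1' [h2' [+ F1]]].
move: s1 s2 h1' h2' F1 h1 h2.
apply: rbisimF_ind => s1 s2 h1' h2'.
- by move=> ne h1 h2 _; exact: rbisimF_leak.
- by move=> IH h1 h2 /IH; exact: rbisimF_nextl.
(* [eqh] excludes a leak difference, so both hardware pairs step together. Lockstep matters: [Rs]
   covers one step of [h1'] and [h2'], while [rbisim] could demand several before [h1] and [h2]
   move. *)
- move=> eqh Rs h1 h2; rewrite /rbisim_lockstep -nu_fix => -[//|[eq1 rh]].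
  by apply: rbisimF_nextr => //; exists (next h1'), (next h2').
Qed.

End Compatibility.

Theorem mainTheorem9 (C H : transitionSystem) :
  compatible (c_swap C H) (rbisimF C H) /\
  compatible (h_swap C H) (rbisimF C H) /\
  compatible (c_leak_eq C H) (rbisimF C H) /\
  compatible (h_leak_eq C H) (rbisimF C H) /\
  compatible (reduce_contract_leakage C H) (rbisimF C H) /\
  compatible (augment_hardware_leakage C H) (rbisimF C H).
Proof.
split; first exact: c_swap_compatible.
split; first exact: h_swap_compatible.
split; first exact: c_leak_eq_compatible.
split; first exact: h_leak_eq_compatible.
split; first exact: reduce_contract_leakage_compatible.
exact: augment_hardware_leakage_compatible.
Qed.
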